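(* Let $G=(V,E)$ be a simple undirected graph and let $H\subseteq V$ be a hole in $G$ of cardinality $|H|=3q+r$, where $q$ is a positive integer and $r\in\{0,1,2\}$. Then the inequality $$\sum_{i\in H}x_i\le 2q+\left\lfloor\frac{2r}{3}\right\rfloor$$ is valid for $\mathscr{P}_{IUC}(G)$. Moreover, (i) it induces a facet of $\mathscr{P}_{IUC}(G[H])$ if and only if $r\ne 0$, and (ii) it is facet-defining for $\mathscr{P}_{IUC}(G)$ if $q=r=1$.
   Context: All graphs are finite, simple and undirected. A subset $U\subseteq V$ of the vertices of $G=(V,E)$ is an independent union of cliques (IUC) if every connected component of the induced subgraph $G[U]$ is a complete graph (equivalently, $G[U]$ has no induced path on three vertices). The IUC polytope $\mathscr{P}_{IUC}(G)\subseteq\mathbb{R}^{V}$ is the convex hull of the incidence vectors of all IUCs of $G$. A hole in $G$ is a subset $H\subseteq V$ with $|H|\ge 4$ such that $G[H]$ is a chordless cycle. *)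

(* Defs.v *)
From HB Require Import structures.
From mathcomp Require Import all_boot all_order all_algebra.
From mathcomp Require Import classical_sets reals.

Set Implicit Arguments.
Unset Strict Implicit.
Unset Printing Implicit Defensive.

Import Order.TTheory GRing.Theory Num.Theory.
Local Open Scope classical_set_scope.
Local Open Scope ring_scope.

Record sgraph := SGraph {
  svertex :> finType;
  sedge : rel svertex;
  sedge_sym : symmetric sedge;
  sedge_irr : irreflexive sedge
}.

Section Graphs.
Variable G : sgraph.
Implicit Types U C H : {set G}.

Definition induced_type U : finType := {x : G | x \in U}.

Definition induced_edge U : rel (induced_type U) :=
  fun x y => sedge (val x) (val y).

Lemma induced_edge_sym U : symmetric (@induced_edge U).
Proof. by move=> x y; rewrite /induced_edge sedge_sym. Qed.

Lemma induced_edge_irr U : irreflexive (@induced_edge U).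
Proof. by move=> x; rewrite /induced_edge sedge_irr. Qed.

Definition induced U : sgraph :=
  SGraph (@induced_edge_sym U) (@induced_edge_irr U).

Definition is_clique C : bool :=
  [forall x in C, forall y in C, (x != y) ==> sedge x y].

Definition component (x : G) : {set G} := [set y | connect (@sedge G) x y].

End Graphs.

Definition IUC (G : sgraph) (U : {set G}) : bool :=
  [forall x : induced U, is_clique (component x)].

(* [c] lists the vertices of [H] in cyclic order; the last clause rules out
   chords. *)
Definition is_hole (G : sgraph) (H : {set G}) : Prop :=
  (4 <= #|H|)%N /\
  exists c : seq G,
    [/\ ucycle (@sedge G) c,
        c =i H &
        {in H &, forall x y, sedge x y -> (y == next c x) || (x == next c y)}].

Section Polyhedra.
Variables (R : realType) (E : lmodType R).

Definition convex_hull (S : set E) : set E :=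
  [set x | exists n (p : 'I_n -> E) (w : 'I_n -> R),
     [/\ forall i, S (p i), forall i, 0 <= w i, \sum_i w i = 1 &
         x = \sum_i w i *: p i]].

Definition affinely_independent n (p : 'I_n -> E) : Prop :=
  forall w : 'I_n -> R,
    \sum_i w i = 0 -> \sum_i w i *: p i = 0 -> forall i, w i = 0.

Definition has_affine_family (S : set E) (n : nat) : Prop :=
  exists p : 'I_n -> E, (forall i, S (p i)) /\ affinely_independent p.

(* [affine_rank S n]: at most [n] points of [S] are affinely independent, and
   [n] is attained. This is the dimension of [S] plus one, so that the empty
   set (of dimension -1) gets 0. *)
Definition affine_rank (S : set E) (n : nat) : Prop :=
  has_affine_family S n /\
  forall m, has_affine_family S m -> (m <= n)%N.

Definition valid_ineq (P : set E) (f : E -> R) (b : R) : Prop :=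
  forall x, P x -> f x <= b.

(* The face where equality holds has dimension one less than [P]. *)
Definition facet_ineq (P : set E) (f : E -> R) (b : R) : Prop :=
  valid_ineq P f b /\
  exists n, affine_rank P n.+1 /\ affine_rank (P `&` [set x | f x = b]) n.

End Polyhedra.

(* [R^o] is [R] seen as a module over itself: it is what makes [vec R G],
   i.e. R^V, a vector space over [R]. *)
Notation vec R G := {ffun svertex G -> R^o}.

Definition incidence (R : realType) (G : sgraph) (U : {set G}) : vec R G :=
  [ffun i => (i \in U)%:R].

Definition IUC_polytope (R : realType) (G : sgraph) : set (vec R G) :=
  convex_hull [set incidence R U | U in [set U | IUC U]].

Arguments IUC_polytope : clear implicits.

(* Main.v *)
(* A set is an IUC iff it contains no induced path on three vertices, so an IUC
   misses a vertex of every window of three consecutive vertices of the hole;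
   summing over the n = 3q + r windows bounds its trace by floor(2n/3).

   Facets are obtained by showing that a linear functional vanishing on all
   tight IUCs is zero. For r <> 0, removing offsets e, 3, 6, ..., 3q from the
   hole leaves a tight IUC both for e = 0 and for e = 1; comparing the two shows
   that the functional is constant along the hole, hence zero there. For a hole
   of size 4, each outside vertex forms an IUC with some pair of hole vertices,
   which kills its coefficient.

   For r = 0, tightness forces every window to sum to 2, hence x_i = x_(i+3):
   the face lies in a second hyperplane and has too small a dimension. *)
Require Import Defs.
From mathcomp Require Import all_boot all_order all_algebra.
From mathcomp Require Import classical_sets reals.
From mathcomp Require Import zify.

Set Implicit Arguments.
Unset Strict Implicit.
Unset Printing Implicit Defensive.

Import Order.TTheory GRing.Theory Num.Theory.
Local Open Scope ring_scope.

(** * Independent unions of cliques as sets without an induced path *)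

Lemma IUC_P (G : sgraph) (U : {set G}) :
  reflect {in U & &, forall x y z, sedge x y -> sedge y z -> x != z ->
             sedge x z}
          (IUC U).
Proof.
apply: (iffP forallP) => [iucU x y z xU yU zU exy eyz xz | P3free].
  pose sub u (uU : u \in U) : induced U := exist _ u uU.
  have exy' : connect (@sedge (induced U)) (sub x xU) (sub y yU).
    exact: connect1.
  have eyz' : connect (@sedge (induced U)) (sub y yU) (sub z zU).
    exact: connect1.
  have /forall_inP/(_ (sub x xU)) := iucU (sub x xU).
  rewrite inE connect0 => /(_ isT)/forall_inP/(_ (sub z zU)).
  by rewrite inE (connect_trans exy' eyz') => /(_ isT)/implyP; apply.
(* By induction on a path, its last edge is absorbed by the absence of an induced path on three
   vertices, so connected vertices are equal or adjacent. *)
have conn (x y : induced U) :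
    connect (@sedge (induced U)) x y -> (x == y) || sedge x y.
  case/connectP=> p; elim/last_ind: p y => [|p z IHp] y /=.
    by move=> _ ->; rewrite eqxx.
  rewrite rcons_path last_rcons => /andP[/IHp/(_ erefl) + elz] ->.
  case/orP=> [/eqP-> | exl]; first by rewrite elz orbT.
  have [//| xz /=] := eqVneq x z.
  exact: (P3free _ (val (last x p)) _ (valP x) (valP _) (valP z)).
move=> x; apply/forall_inP=> y; rewrite inE => xy.
apply/forall_inP=> z; rewrite inE => xz; apply/implyP=> /negPf yz.
have /conn : connect (@sedge (induced U)) y z.
  apply: connect_trans xz.
  by rewrite (sym_connect_sym (@sedge_sym (induced U))).
by rewrite yz.
Qed.

(** Three distinct vertices induce a path exactly when they span two edges. *)
Lemma IUC_triple (G : sgraph) (x y z : G) :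
  (sedge x y + sedge y z + sedge x z)%N != 2%N -> IUC [set x; y; z].
Proof.
move=> edges; apply/IUC_P => u v w.
rewrite !inE -!orbA.
have sy := @sedge_sym G; have ir := @sedge_irr G.
by move=> /or3P[] /eqP-> /or3P[] /eqP-> /or3P[] /eqP-> //;
   rewrite ?ir ?eqxx // => e1 e2 _; move: edges e1 e2;
   rewrite ?(sy y x) ?(sy z x) ?(sy z y);
   do 3 case: sedge.
Qed.

Lemma IUC_set1 (G : sgraph) (x : G) : IUC [set x].
Proof. by apply/IUC_P => u v w /set1P-> /set1P-> /set1P->. Qed.

Lemma IUC_set0 (G : sgraph) : IUC (@finset.set0 G).
Proof. by apply/IUC_P => u v w; rewrite inE. Qed.

(** * Points of the polytope and validity of inequalities *)

Lemma IUC_polytope_incidence (R : realType) (G : sgraph) (U : {set G}) :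
  IUC U -> IUC_polytope R G (incidence R U).
Proof.
move=> iucU; exists 1%N, (fun=> incidence R U), (fun=> 1).
by split=> //; [move=> _; exists U | rewrite big_ord1
               | rewrite big_ord1 scale1r].
Qed.

Lemma sum_incidence (R : realType) (G : sgraph) (s : seq G) (P : pred G)
    (U : {set G}) :
  \sum_(i <- s | P i) incidence R U i =
  (\sum_(i <- s | P i) (i \in U))%N%:R :> R.
Proof. by rewrite natr_sum; apply: eq_bigr => i _; rewrite ffunE. Qed.

(** A bound at the generators passes to convex combinations. The list [s] allows sums over the hole
    as well as over a single window. *)
Lemma IUC_polytope_sum_le (R : realType) (G : sgraph) (s : seq G) (P : pred G)
    (b : nat) (x : vec R G) :
    (forall U, IUC U -> (\sum_(i <- s | P i) (i \in U) <= b)%N) ->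
  IUC_polytope R G x -> \sum_(i <- s | P i) x i <= b%:R.
Proof.
move=> le_b [n [p [w [pS w_ge0 w_sum ->]]]].
have -> : \sum_(i <- s | P i) (\sum_j w j *: p j) i =
          \sum_j w j * \sum_(i <- s | P i) p j i.
  under [RHS]eq_bigr do rewrite mulr_sumr.
  rewrite exchange_big; apply: eq_bigr => i _.
  by rewrite sum_ffunE; apply: eq_bigr => j _; rewrite ffunE.
rewrite -[leRHS]mul1r -[X in X * _]w_sum mulr_suml; apply: ler_sum => j _.
apply: ler_wpM2l => //; have [U iucU <-] := pS j.
by rewrite sum_incidence ler_nat le_b.
Qed.

(** * Affine rank and a criterion for facets *)

Lemma mul_row_eq0_le (F : fieldType) (m d : nat) (M : 'M[F]_(m, d)) :
  (forall w : 'rV_m, w *m M = 0 -> w = 0) -> (m <= d)%N.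
Proof.
move=> inj; have /eqP <- : row_free M.
  by rewrite -kermx_eq0; apply/rowV0P => w /sub_kermxP/inj.
exact: rank_leq_col.
Qed.

Section AffineRank.
Variables (R : realType) (G : sgraph).

Definition points_mx (n : nat) (p : 'I_n -> vec R G) : 'M[R]_(n, #|G|) :=
  \matrix_(i, j) p i (enum_val j).

Lemma mul_points_mx (n : nat) (p : 'I_n -> vec R G) (w : 'rV[R]_n) :
  w *m points_mx p = 0 <-> \sum_i w 0 i *: p i = 0.
Proof.
have E g : (w *m points_mx p) 0 (enum_rank g) = (\sum_i w 0 i *: p i) g.
  rewrite mxE sum_ffunE; apply: eq_bigr => i _.
  by rewrite ffunE mxE enum_rankK.
split=> wp0; first by apply/ffunP => g; rewrite -E wp0 !(ffunE, mxE).
by apply/rowP => j; rewrite -[j]enum_valK E wp0 !(ffunE, mxE).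
Qed.

(** Appending a column of ones to the matrix of the points turns affine independence into linear
    independence of rows. *)
Lemma affine_family_le (n : nat) (p : 'I_n -> vec R G) :
  affinely_independent p -> (n <= #|G|.+1)%N.
Proof.
move=> indep; rewrite -addn1.
pose M : 'M[R]_(n, #|G| + 1) := row_mx (points_mx p) (const_mx 1).
apply: (mul_row_eq0_le (M := M)) => w.
rewrite mul_mx_row => /eqP; rewrite row_mx_eq0.
move=> /andP[/eqP/mul_points_mx wp /eqP w1].
apply/rowP => i; rewrite [RHS]mxE; apply: (indep (w 0)) => //.
have /rowP/(_ 0) := w1; rewrite !mxE => wE; apply: etrans wE.
by apply: eq_bigr => j _; rewrite mxE mulr1.
Qed.

(** Applying the functional to a linear relation gives b times the sum of the weights, so this sum
    vanishes: off the origin, affine independence is linear independence. *)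
Lemma hyperplane_family_independent (n : nat) (p : 'I_n -> vec R G) (P : pred G)
    (b : R) :
    b != 0 -> (forall j, \sum_(i | P i) p j i = b) ->
  affinely_independent p ->
  forall w : 'I_n -> R, \sum_i w i *: p i = 0 -> forall i, w i = 0.
Proof.
move=> b_neq0 pb indep w wp; apply: indep (wp).
apply: (mulIf b_neq0); rewrite mul0r mulr_suml.
have -> : \sum_j w j * b = \sum_(g | P g) \sum_j w j * p j g.
  rewrite exchange_big; apply: eq_bigr => j _ /=.
  by rewrite -(pb j) mulr_sumr.
apply: big1 => g _.
have /ffunP/(_ g) := wp; rewrite sum_ffunE ffunE => wE; apply: etrans wE.
by apply: eq_bigr => j _; rewrite ffunE.
Qed.

(** The polytope is full-dimensional: it contains the origin and all unit vectors, from the empty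
    set and the singletons. *)
Lemma IUC_polytope_rank (n : nat) :
  affine_rank (IUC_polytope R G) n <-> n = #|G|.+1.
Proof.
have fam : has_affine_family (IUC_polytope R G) #|G|.+1.
  pose U (i : 'I_#|G|.+1) : {set G} :=
    if unlift ord0 i is Some j then [set enum_val j] else finset.set0.
  exists (fun i => incidence R (U i)); split.
    move=> i; apply: IUC_polytope_incidence; rewrite /U.
    by case: unlift => [j|]; [apply: IUC_set1 | apply: IUC_set0].
  move=> w w_sum w_p.
  have w_lift j : w (lift ord0 j) = 0.
    have /ffunP/(_ (enum_val j)) := w_p.
    rewrite sum_ffunE ffunE big_ord_recl !ffunE /U unlift_none inE scaler0.
    rewrite add0r.
    rewrite (bigD1 j) //= !ffunE liftK inE eqxx big1 => [|k kj].
      by rewrite addr0 => wE; apply: etrans wE; rewrite -[LHS]mulr1.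
    by rewrite !ffunE liftK inE (inj_eq enum_val_inj) eq_sym (negPf kj) scaler0.
  move: w_sum; rewrite big_ord_recl big1 ?addr0 => [w0 i|j _]; last first.
    exact: w_lift.
  by case: (unliftP ord0 i) => [j ->|->].
split=> [[[p [_ indep]] max]|->].
  by apply/eqP; rewrite eqn_leq max ?andbT // (affine_family_le indep).
by split=> // m [p [_ /affine_family_le]].
Qed.

(** If only the zero functional kills all [v i], their matrix has full column rank, and a maximal
    set of independent rows is a basis. *)
Lemma independent_subfamily (I : finType) (v : I -> vec R G) :
    (forall a : G -> R, (forall i, \sum_g a g * v i g = 0) ->
       forall g, a g = 0) ->
  exists f : 'I_#|G| -> I, forall w : 'I_#|G| -> R,
    \sum_j w j *: v (f j) = 0 -> forall j, w j = 0.
Proof.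
move=> span; pose M := points_mx (fun i : 'I_#|I| => v (enum_val i)).
have full : row_full M.
  rewrite -[row_full M]/(\rank M == #|G|) -mxrank_tr -/(row_free _) -kermx_eq0.
  apply/rowV0P => a /sub_kermxP aM; apply/rowP => j; rewrite [RHS]mxE.
  rewrite -[j]enum_valK; apply: (span (fun g => a 0 (enum_rank g))) => i.
  have /rowP/(_ (enum_rank i)) := aM; rewrite !mxE => wE; apply: etrans wE.
  rewrite (reindex _ (onW_bij _ (enum_val_bij G))) /=.
  by apply: eq_bigr => k _; rewrite !mxE enum_valK enum_rankK.
pose f j := enum_val (fullrankfun full j).
exists f => w wv j; suff : \row_j w j = 0 :> 'rV[R]_#|G|.
  by move/rowP/(_ j); rewrite !mxE.
have fM : points_mx (fun j => v (f j)) = rowsub (fullrankfun full) M.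
  by apply/matrixP => i k; rewrite !mxE.
have /row_free_inj : row_free (rowsub (fullrankfun full) M).
  by rewrite /row_free mxrank_fullrowsub.
apply; rewrite mul0mx -fM; apply/mul_points_mx.
by under eq_bigr do rewrite mxE.
Qed.

(** As many independent vectors as coordinates form an invertible matrix. *)
Lemma independent_dual (p : 'I_#|G| -> vec R G) :
    (forall w : 'I_#|G| -> R, \sum_i w i *: p i = 0 -> forall i, w i = 0) ->
  forall a : G -> R, (forall j, \sum_g p j g * a g = 0) -> forall g, a g = 0.
Proof.
move=> indep a pa g; have unitp : points_mx p \in unitmx.
  rewrite -row_free_unit -kermx_eq0.
  apply/rowV0P => w /sub_kermxP/mul_points_mx wp.
  by apply/rowP => j; rewrite [RHS]mxE; apply: (indep (w 0)).
suff /(canRL (mulKmx unitp)) : points_mx p *m (\col_j a (enum_val j)) = 0.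
  by rewrite mulmx0 => /colP/(_ (enum_rank g)); rewrite !mxE enum_rankK.
apply/colP => j; rewrite !mxE; apply: etrans (pa j).
rewrite [RHS](reindex _ (onW_bij _ (enum_val_bij G))) /=.
by apply: eq_bigr => k _; rewrite !mxE.
Qed.

(** Since [b] is positive, the hyperplane misses the origin, so the face has at most [#|G|] affinely
    independent points; the tight IUCs span the space and supply that many. *)
Lemma IUC_facet (P : pred G) (b : nat) :
    (0 < b)%N ->
    (forall U : {set G}, IUC U -> (\sum_(i | P i) (i \in U) <= b)%N) ->
    (forall a : G -> R,
       (forall U : {set G}, IUC U -> (\sum_(i | P i) (i \in U))%N = b ->
          \sum_(i in U) a i = 0) ->
       forall g, a g = 0) ->
  facet_ineq (IUC_polytope R G) (fun x => \sum_(i | P i) x i) b%:R.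
Proof.
move=> b_gt0 le_b span; split=> [x|]; first exact: IUC_polytope_sum_le.
exists #|G|; split; first exact/IUC_polytope_rank.
have b_neq0 : b%:R != 0 :> R by rewrite pnatr_eq0 -lt0n.
split=> [|m [p [pP indep]]]; last first.
  have pb j : \sum_(i | P i) p j i = b%:R by case: (pP j).
  apply: (mul_row_eq0_le (M := points_mx p)) => w /mul_points_mx wp.
  apply/rowP => j; rewrite [RHS]mxE.
  exact: (hyperplane_family_independent b_neq0 pb indep (w := w 0)).
pose tight (U : {set G}) := IUC U && ((\sum_(i | P i) (i \in U))%N == b).
have [|f indep] :=
  @independent_subfamily {U | tight U} (fun U => incidence R (val U)).
  move=> a orth; apply: span => U iucU /eqP Ub.
  have tU : tight U by rewrite /tight iucU.
  rewrite -[RHS](orth (exist _ U tU)) big_mkcond; apply: eq_bigr => g _.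
  by rewrite ffunE /=; case: (g \in U); rewrite ?mulr1 ?mulr0.
exists (fun j => incidence R (val (f j))); split=> [j|w _]; last exact: indep.
have /andP[iucU /eqP Ub] := valP (f j).
by split; [apply: IUC_polytope_incidence | rewrite /= sum_incidence Ub].
Qed.

End AffineRank.

(** * Periodic enumeration of a hole *)

(* [h] runs through the hole [H] periodically, so that rotations of the hole
   are translations of the index. *)
Record cyclic_enum (G : sgraph) (H : {set G}) (n : nat) (h : nat -> G) : Prop :=
  CyclicEnum {
    cyc_ge4 : (4 <= n)%N;
    cyc_mem : forall i, h i \in H;
    cyc_onto : forall x, x \in H -> exists2 i, (i < n)%N & h i = x;
    cyc_eq : forall i j, (h i == h j) = (i == j %[mod n]);
    cyc_edge : forall i j,
      sedge (h i) (h j) = (h j == h i.+1) || (h i == h j.+1)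
  }.

Lemma hole_cyclic_enum (G : sgraph) (H : {set G}) :
  is_hole H -> exists h, cyclic_enum H #|H| h.
Proof.
case=> H_ge4 [c [/andP[cyc uc] cH chord]].
have szc : size c = #|H|.
  by rewrite (eq_card (fun x => esym (cH x))) (card_uniqP uc).
have c_gt0 : (0 < size c)%N by rewrite szc (leq_trans _ H_ge4).
case: c => [//|y s] in cyc uc cH chord szc c_gt0 *.
set c := y :: s in cyc uc cH chord szc c_gt0.
pose h i := nth y c (i %% size c).
have hc i : h i \in c by rewrite mem_nth // ltn_pmod.
have h_eq i j : (h i == h j) = (i == j %[mod size c]).
  by rewrite nth_uniq // ltn_pmod.
have h_next i : next c (h i) = h i.+1.
  rewrite next_nth hc index_uniq ?ltn_pmod // /h -[i.+1]addn1 -modnDml.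
  have := ltn_pmod i c_gt0; set k := (i %% _)%N.
  rewrite leq_eqVlt => /predU1P[k1|k1]; last by rewrite modn_small addn1.
  (* At the last position [next] wraps around to the head [y], which is the default value of
     [nth]. *)
  rewrite addn1 k1 modnn /c /= nth_default //.
  by have [->] : k.+1 = (size s).+1 := k1.
exists h; rewrite -szc; split=> //; first by rewrite szc.
- by move=> i; rewrite -cH.
- move=> x; rewrite -cH => xc; exists (index x c); first by rewrite index_mem.
  by rewrite /h modn_small ?index_mem // nth_index.
move=> i j; rewrite -!h_next; apply/idP/idP.
  by apply: chord; rewrite -cH.
by case/orP=> /eqP->; last rewrite sedge_sym; apply: next_cycle.
Qed.

(** Transfers the results on holes to G[H], where the hole is the whole vertex set. *)
Lemma cyclic_enum_induced (G : sgraph) (H : {set G}) (n : nat) (h : nat -> G) :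
  cyclic_enum H n h ->
  exists h', @cyclic_enum (induced H) [set: induced H] n h'.
Proof.
move=> hP; exists (fun i => exist _ (h i) (cyc_mem hP i)); split.
- exact: cyc_ge4 hP.
- by move=> i; rewrite inE.
- move=> x _; have [i i_lt hi] := cyc_onto hP (valP x).
  by exists i => //; apply: val_inj.
- by move=> i j; rewrite -(cyc_eq hP).
- by move=> i j; rewrite -!val_eqE /= -(cyc_edge hP).
Qed.

(** * Windows of the hole and the upper bound *)

Section Hole.
Variables (G : sgraph) (H : {set G}) (n : nat) (h : nat -> G).
Hypothesis hP : cyclic_enum H n h.

Lemma cyc_offset (k : nat) (x : G) :
  x \in H -> exists2 d, (d < n)%N & h (k + d)%N = x.
Proof.
have n_gt0 : (0 < n)%N by have := cyc_ge4 hP; lia.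
(* The offset is i - k modulo n, arranged so that the subtraction does not truncate. *)
case/(cyc_onto hP) => i i_lt <-; exists ((i + (n - k %% n)) %% n)%N.
  exact: ltn_pmod.
apply/eqP; rewrite (cyc_eq hP) modnDmr -modnDml addnCA subnKC.
  by rewrite modnDr.
exact/ltnW/ltn_pmod.
Qed.

Lemma cyc_offset_inj (k d e : nat) :
  (d < n)%N -> (e < n)%N -> (h (k + d)%N == h (k + e)%N) = (d == e).
Proof. by move=> dn en; rewrite (cyc_eq hP) eqn_modDl !modn_small. Qed.

Lemma cyc_eqS (i j : nat) : (h i.+1 == h j.+1) = (h i == h j).
Proof. by rewrite !(cyc_eq hP) -[i.+1]addn1 -[j.+1]addn1 eqn_modDr. Qed.

Lemma big_hole (V : nmodType) (F : G -> V) (k : nat) :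
  \sum_(i in H) F i = \sum_(0 <= d < n) F (h (k + d)%N).
Proof.
rewrite -big_enum -(big_map (fun d => h (k + d)%N) xpredT F) /=.
apply: perm_big; apply: uniq_perm; first exact: enum_uniq.
  rewrite map_inj_in_uniq ?iota_uniq // => d e.
  rewrite !mem_index_iota /= => dn en /eqP.
  by rewrite cyc_offset_inj // => /eqP.
move=> x; rewrite mem_enum.
apply/idP/mapP => [/(cyc_offset k)[d dn <-]|[d _ ->]].
  by exists d; rewrite ?mem_index_iota.
exact: cyc_mem hP _.
Qed.

Lemma IUC_no_window (U : {set G}) (k : nat) : IUC U ->
  ~~ [&& h k \in U, h k.+1 \in U & h k.+2 \in U].
Proof.
move=> /IUC_P P3free; have n_ge4 := cyc_ge4 hP; apply/and3P => -[U0 U1 U2].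
(* Four consecutive vertices are distinct, so [h k] and [h k.+2] are distinct and not adjacent. *)
have h_neq d e : (d < 4)%N -> (e < 4)%N -> (h (k + d)%N == h (k + e)%N) = (d == e).
  by move=> d4 e4; rewrite cyc_offset_inj // (leq_trans _ n_ge4).
have := P3free _ _ _ U0 U1 U2.
have := P3free _ _ _ U0 U1 U2; rewrite !(cyc_edge hP) !eqxx /= !cyc_eqS.
have /= := h_neq 0 2 isT isT; have /= := h_neq 0 3 isT isT.
have /= := h_neq 0 1 isT isT.
rewrite addn0 addn1 addn2 addn3 (eq_sym (h k.+1)) => -> -> -> /=.
by move=> _ /(_ isT isT isT).
Qed.

Lemma no_window_IUC (U : {set G}) : U \subset H ->
  (forall k, ~~ [&& h k \in U, h k.+1 \in U & h k.+2 \in U]) -> IUC U.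
Proof.
move=> /fintype.subsetP UH noW; apply/IUC_P => x y z xU yU zU.
move: (xU) (yU) (zU).
have [i _ <-] := cyc_onto hP (UH x xU); have [j _ <-] := cyc_onto hP (UH y yU).
have [l _ <-] := cyc_onto hP (UH z zU) => iU jU lU.
rewrite (cyc_edge hP i j) (cyc_edge hP j l).
(* If both edges run in the same direction, the three vertices form a window, starting at [i] or at
   [l]; otherwise the two ends coincide. *)
case/orP=> /eqP ij /orP[] /eqP jl => [|/negP[]|/negP[]|].
- have /eqP il : h j.+1 == h i.+2 by rewrite cyc_eqS ij.
  by have := noW i; rewrite iU -ij jU -il -jl lU.
- by rewrite -cyc_eqS -ij jl.
- by rewrite ij jl.
have /eqP il : h j.+1 == h l.+2 by rewrite cyc_eqS jl.
by have := noW l; rewrite lU -jl jU -il -ij iU.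
Qed.

Lemma hole_card_le (U : {set G}) :
  IUC U -> (\sum_(i in H) (i \in U) <= 2 * n %/ 3)%N.
Proof.
move=> iucU; rewrite leq_divRL //.
suff : (\sum_(i in H) (i \in U) + \sum_(i in H) (i \in U) +
        \sum_(i in H) (i \in U) <= \sum_(0 <= d < n) 2)%N.
  by rewrite sum_nat_const_nat; lia.
(* Starting the three copies of the sum at 0, 1 and 2 regroups them by windows, each of which
   contributes at most 2. *)
rewrite {1}(big_hole _ 0) {1}(big_hole _ 1) {1}(big_hole _ 2) /= -!big_split /=.
apply: leq_sum => d _; have := IUC_no_window d iucU.
by do 3 case: (_ \in U).
Qed.

End Hole.

(** * Tight sets when the size of the hole is not a multiple of three *)

Section TightSets.
Variables (G : sgraph) (H : {set G}) (q r : nat) (h : nat -> G).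
Hypotheses (hP : cyclic_enum H (3 * q + r) h) (r_gt0 : (0 < r)%N)
  (r_lt3 : (r < 3)%N).

Let keep (e d : nat) : bool := (d != e) && ((d == 0%N) || ~~ (3 %| d)%N).

(* For [e <= 1], the hole minus the vertices at offsets [e], 3, 6, ..., [3 * q]
   from [h k]. *)
Definition tight_set (k e : nat) : {set G} :=
  [set h (k + val d)%N | d : 'I_(3 * q + r) & keep e d].

Lemma mem_tight_set (k e d : nat) :
  (d < 3 * q + r)%N -> (h (k + d)%N \in tight_set k e) = keep e d.
Proof.
move=> dn; apply/imsetP/idP => [[d' kd' /eqP]|kd].
  by rewrite (cyc_offset_inj hP) ?ltn_ord // => /eqP->; rewrite inE in kd'.
by exists (Ordinal dn); rewrite ?inE.
Qed.

Lemma tight_set_sub (k e : nat) : tight_set k e \subset H.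
Proof. by apply/fintype.subsetP => x /imsetP[d _ ->]; apply: cyc_mem hP _. Qed.

(** Cyclically consecutive removed offsets are at most 3 apart, the gap from [3 * q] round to [e]
    being [r + e]; hence every window loses a vertex. *)
Lemma IUC_tight_set (k e : nat) : (e <= 1)%N -> IUC (tight_set k e).
Proof.
move=> e_le1; apply: (no_window_IUC hP (tight_set_sub k e)) => i.
have n_gt0 : (0 < 3 * q + r)%N by lia.
have [d dn /eqP di] := cyc_offset hP k (cyc_mem hP i).
have /eqP <- : h (k + d).+1%N == h i.+1 by rewrite (cyc_eqS hP).
have /eqP <- : h (k + d).+2%N == h i.+2 by rewrite !(cyc_eqS hP).
rewrite -(eqP di) -!addnS mem_tight_set //.
have wrap m : h (k + (3 * q + r + m))%N = h (k + m)%N.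
  by apply/eqP; rewrite (cyc_eq hP) addnCA modnDl.
have keep01 : ~~ (keep e 0 && keep e 1) by case: e e_le1 => [|[]].
(* The cases are windows with no vertex, one vertex or two vertices past the last offset. *)
have [d2_lt|] := ltnP d.+2 (3 * q + r).
  rewrite !mem_tight_set // 1?ltnW // /keep.
  case: d {dn di} d2_lt => [|d] _; first by case: e e_le1 keep01 => [|[]].
  have : [|| 3 %| d.+1, 3 %| d.+2 | 3 %| d.+3]%N by lia.
  by case/or3P=> ->; rewrite /= ?andbF.
rewrite leq_eqVlt => /predU1P[n_d2|d1_ge].
  rewrite -n_d2 -[(3 * q + r)%N]addn0 wrap !mem_tight_set ?n_d2 ?ltnS //.
  have : (3 %| d)%N || (3 %| d.+1)%N by lia.
  have -> : d = d.-1.+1 by have := cyc_ge4 hP; lia.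
  by rewrite /keep => /orP[] ->; rewrite /= ?andbF.
have n_d1 : (3 * q + r = d.+1)%N by apply/eqP; rewrite eqn_leq dn -ltnS d1_ge.
rewrite -[d.+2]addn1 -n_d1 wrap -[(3 * q + r)%N]addn0 wrap !mem_tight_set //.
  by rewrite negb_and keep01 orbT.
by have := cyc_ge4 hP; lia.
Qed.

Lemma sum_tight_set (V : nmodType) (a : G -> V) (k e : nat) :
  \sum_(i in tight_set k e) a i =
  \sum_(0 <= d < 3 * q + r) if keep e d then a (h (k + d)%N) else 0.
Proof.
have -> : \sum_(i in tight_set k e) a i =
    \sum_(i in H) if i \in tight_set k e then a i else 0.
  rewrite -big_mkcondr; apply: eq_bigl => i /=; rewrite andbC.
  by case: (boolP (i \in _)) => // /(fintype.subsetP (tight_set_sub k e)) ->.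
rewrite (big_hole hP _ k); apply: eq_big_nat => d /andP[_ dn].
by rewrite mem_tight_set.
Qed.

(** There are [q + 1] removed offsets. In the induction on [q], exactly one of the three new offsets
    is a multiple of 3. *)
Lemma tight_set_card (k e : nat) : (0 < q)%N -> (e <= 1)%N ->
  (\sum_(i in H) (i \in tight_set k e))%N = (2 * q + r.-1)%N.
Proof.
move=> q_gt0 e_le1; rewrite (big_hole hP _ k).
rewrite (eq_big_nat _ _ (F2 := fun d => nat_of_bool (keep e d))); last first.
  by move=> d /andP[_ dn]; rewrite mem_tight_set.
rewrite -(prednK q_gt0); elim: q.-1 => [|m IHm].
  rewrite unlock; move: e e_le1 r r_gt0 r_lt3 => [|[|//]] _ [|[|[|//]]] //=.
have -> : (3 * m.+2 + r = (3 * m.+1 + r).+3)%N by lia.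
rewrite 3?big_nat_recr //= IHm /keep; lia.
Qed.

(** The two sets agree from offset 2 on; the first contains [h k.+1] where the second contains
    [h k]. *)
Lemma eq_on_hole (V : zmodType) (a : G -> V) (k : nat) : (0 < q)%N ->
    \sum_(i in tight_set k 0) a i = \sum_(i in tight_set k 1) a i ->
  a (h k.+1) = a (h k).
Proof.
move=> q_gt0; rewrite !sum_tight_set.
have n_gt1 : (1 < 3 * q + r)%N by lia.
rewrite !(big_ltn (ltnW n_gt1)) !(big_ltn n_gt1).
rewrite /= !add0r addn0 addn1.
rewrite [in RHS](eq_big_nat _ _
  (F2 := fun d => if keep 0 d then a (h (k + d)%N) else 0)).
  by move/addIr.
by move=> [|[|d]] //.
Qed.

Lemma tight_functional (R : realType) (a : G -> R) : (0 < q)%N ->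
    (forall U : {set G}, IUC U -> U \subset H ->
       (\sum_(i in H) (i \in U))%N = (2 * q + r.-1)%N ->
       \sum_(i in U) a i = 0) ->
  forall i, i \in H -> a i = 0.
Proof.
move=> q_gt0 orth.
have sum0 k e : (e <= 1)%N -> \sum_(i in tight_set k e) a i = 0.
  move=> e_le1.
  by apply: orth; [exact: IUC_tight_set | exact: tight_set_sub
                  | exact: tight_set_card].
have a_const k : a (h k) = a (h 0).
  by elim: k => // k <-; apply: eq_on_hole => //; rewrite !sum0.
suff a0 : a (h 0) = 0 by move=> i /(cyc_onto hP)[k _ <-]; rewrite a_const.
have := sum0 0 0 isT; rewrite (eq_bigr (fun=> a (h 0))) => [|i]; last first.
  by move/(fintype.subsetP (tight_set_sub 0 0))/(cyc_onto hP)=> [k _ <-].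
rewrite sumr_const => /eqP; rewrite mulrn_eq0 => /predU1P[/eqP|/eqP //].
rewrite cards_eq0 => /eqP U0.
(* Offset 2 is never removed, so the tight set is nonempty and the constant value must be zero. *)
have : h (0 + 2)%N \in tight_set 0 0.
  by rewrite mem_tight_set //; have := cyc_ge4 hP; lia.
by rewrite U0 inE.
Qed.

End TightSets.

(** * Holes whose size is a multiple of three *)

Lemma tight_period3 (R : realType) (G : sgraph) (H : {set G}) (q : nat)
    (h : nat -> G) (x : vec R G) (k : nat) :
    cyclic_enum H (3 * q) h -> IUC_polytope R G x ->
    \sum_(i in H) x i = (2 * q)%:R ->
  x (h k) = x (h (k + 3)%N).
Proof.
move=> hP xP xH; have n_gt0 : (0 < 3 * q)%N by have := cyc_ge4 hP; lia.
pose W k : R := x (h k) + x (h k.+1) + x (h k.+2).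
have W_le2 m : 0 <= 2 - W m.
  rewrite subr_ge0.
  have -> : W m = \sum_(i <- [:: h m; h m.+1; h m.+2]) x i.
    by rewrite !big_cons big_nil addr0 addrA.
  apply: IUC_polytope_sum_le xP => U iucU.
  rewrite !big_cons big_nil /=; have := IUC_no_window hP m iucU.
  by do 3 case: (_ \in U).
(* The slacks add up to 2(3q) - 3(2q) = 0; being nonnegative, each of them vanishes. *)
have W_sum m : \sum_(0 <= d < 3 * q) (2 - W (m + d)%N) = 0.
  have sumx j : \sum_(0 <= d < 3 * q) x (h (j + d)%N) = (2 * q)%:R :> R.
    by rewrite -(big_hole hP (fun i => x i : R)).
  have sumx1 : \sum_(0 <= d < 3 * q) x (h (m + d).+1) = (2 * q)%:R :> R :=
    sumx m.+1.
  have sumx2 : \sum_(0 <= d < 3 * q) x (h (m + d).+2) = (2 * q)%:R :> R :=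
    sumx m.+2.
  rewrite sumrB /W !big_split /= sumx sumx1 sumx2.
  rewrite sumr_const_nat subn0 -!natrD.
  by apply/eqP; rewrite subr_eq0; apply/eqP; congr (_%:R); lia.
have W_eq m : W m = 2.
  have := W_sum m; rewrite big_ltn // addn0 => /eqP.
  rewrite paddr_eq0 ?W_le2 ?sumr_ge0 // => /andP[+ _].
  by rewrite subr_eq0 => /eqP.
have : W k = W k.+1 by rewrite !W_eq.
by rewrite /W -addrA addrC => /addrI ->; rewrite addn3.
Qed.

Lemma not_facet_mod3 (R : realType) (G : sgraph) (H : {set G}) (q : nat)
    (h : nat -> G) :
    cyclic_enum H (3 * q) h ->
  ~ facet_ineq (IUC_polytope R G) (fun x => \sum_(i in H) x i) (2 * q)%:R.
Proof.
move=> hP [_ [n [/IUC_polytope_rank[->] [[p [pP indep]] _]]]].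
have b_neq0 : (2 * q)%:R != 0 :> R.
  by rewrite pnatr_eq0; have := cyc_ge4 hP; lia.
have pH j : \sum_(i in H) p j i = (2 * q)%:R by case: (pP j).
(* This functional vanishes on the face by periodicity, yet it is nonzero because [h 0] and [h 3]
   differ; a facet would have enough independent points to exclude it. *)
pose a g : R := (g == h 0)%:R - (g == h 3)%:R.
have sum_delta (F : G -> R) x : \sum_g F g * (g == x)%:R = F x.
  rewrite (bigD1 x) //= eqxx mulr1 big1 ?addr0 // => g /negPf->.
  by rewrite mulr0.
have /(_ a) := independent_dual (hyperplane_family_independent b_neq0 pH indep).
have pa j : \sum_g p j g * a g = 0.
  under eq_bigr do rewrite mulrBr.
  rewrite sumrB !(sum_delta (fun g => p j g)).
  by rewrite (tight_period3 0 hP _ (pH j)) ?subrr //; case: (pP j).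
move=> /(_ pa (h 0))/eqP; rewrite /a eqxx (cyc_eq hP) mod0n.
rewrite modn_small; last by have := cyc_ge4 hP; lia.
by rewrite subr0 oner_eq0.
Qed.

(** * Vertices outside a hole of size four, and the conclusion *)

Lemma tight_functional_outside (R : realType) (G : sgraph) (H : {set G})
    (h : nat -> G) (a : G -> R) :
    cyclic_enum H 4 h -> (forall i, i \in H -> a i = 0) ->
    (forall U : {set G}, IUC U -> (\sum_(i in H) (i \in U))%N = 2 ->
       \sum_(i in U) a i = 0) ->
  forall v, v \notin H -> a v = 0.
Proof.
move=> hP aH orth v vH.
have pair i j : (i < j < 4)%N ->
    (sedge v (h i) + sedge (h i) (h j) + sedge v (h j))%N != 2%N -> a v = 0.
  move=> /andP[ij j4] /IUC_triple iucU.
  have hij : h i != h j.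
    by rewrite (cyc_eq hP) !modn_small ?(ltn_trans ij) // ltn_eqF.
  have Ub : (\sum_(x in H) (x \in [set v; h i; h j]))%N = 2%N.
    rewrite (bigD1 (h i)) ?(cyc_mem hP) //= (bigD1 (h j)) /=; last first.
      by rewrite (cyc_mem hP) eq_sym.
    rewrite big1 ?inE ?eqxx ?orbT // => x /andP[/andP[xH xi] xj].
    rewrite !inE (negPf xi) (negPf xj) !orbF.
    by case: eqP xH vH => // -> ->.
  have := orth _ iucU Ub; rewrite (bigD1 v) ?inE ?eqxx //= big1 ?addr0 // => x.
  rewrite !inE => /andP[/orP[/orP[->//|/eqP->]|/eqP->] _];
    exact/aH/(cyc_mem hP).
(* An opposite pair works unless [v] is adjacent to both its vertices; if both opposite pairs fail,
   [v] forms a triangle with [h 0] and [h 1]. *)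
have := pair 0 2 isT; have := pair 1 3 isT; have := pair 0 1 isT.
rewrite !(cyc_edge hP) !(cyc_eq hP) /=.
by do 4 case: (sedge v _) => //=; do ?[move/(_ isT)=> //|move=> _].
Qed.

Theorem theorem3 (R : realType) (G : sgraph) (H : {set G}) (q r : nat)
    (holeH : is_hole H) (q_gt0 : (0 < q)%N) (r_lt3 : (r < 3)%N)
    (cardH : #|H| = (3 * q + r)%N) :
  let b : R := (2 * q + (2 * r) %/ 3)%:R in
  [/\ valid_ineq (IUC_polytope R G) (fun x => \sum_(i in H) x i) b,
      facet_ineq (IUC_polytope R (induced H))
        (fun x => \sum_(i : induced H) x i) b <-> r <> 0%N &
      q = 1%N -> r = 1%N ->
        facet_ineq (IUC_polytope R G) (fun x => \sum_(i in H) x i) b].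
Proof.
have [h] := hole_cyclic_enum holeH; rewrite cardH => hP b.
have [h' hP'] := cyclic_enum_induced hP.
have bE : (2 * (3 * q + r) %/ 3 = 2 * q + 2 * r %/ 3)%N by lia.
have le_b (U : {set G}) :
    IUC U -> (\sum_(i in H) (i \in U) <= 2 * q + 2 * r %/ 3)%N.
  by move/(hole_card_le hP); rewrite bE.
split; first by move=> x; apply: IUC_polytope_sum_le.
- have allE (V : nmodType) (F : induced H -> V) :
      \sum_(i : induced H) F i = \sum_(i in [set: induced H]) F i.
    by apply: eq_bigl => i; rewrite inE.
  split=> [facet r0|/eqP r_neq0].
    subst r; rewrite addn0 in hP'.
    apply: (not_facet_mod3 (R := R) hP').
    have -> : (fun x : vec R (induced H) => \sum_(i in [set: induced H]) x i) =
              (fun x => \sum_i x i).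
      by apply/boolp.funext => x; rewrite allE.
    by rewrite -[(2 * q)%N]addn0.
  have r_gt0 : (0 < r)%N by rewrite lt0n.
  (* For r = 1 and r = 2 the floor of 2r/3 is r - 1, as in the count of the tight sets. *)
  have bE' : (2 * q + 2 * r %/ 3 = 2 * q + r.-1)%N by lia.
  apply: IUC_facet => [|U|a orth g]; first by lia.
    by move/(hole_card_le hP'); rewrite bE allE.
  apply: (tight_functional hP' r_gt0 r_lt3 q_gt0 _ (finset.in_setT g)).
  move=> U iucU _ Ub.
  by apply: orth => //; rewrite bE' allE.
move=> q1 r1; subst q r.
apply: IUC_facet => // a orth.
have aH : forall i, i \in H -> a i = 0.
  by apply: (tight_functional hP) => // U iucU _; apply: orth.
move=> g; have [/aH//|] := boolP (g \in H).
exact: tight_functional_outside hP aH orth g.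
Qed.
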